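(* Let $A,B\in\mathrm{SL}_2\mathbb{Z}_{\ge0}$ be noncommuting and such that the pair $A,B$ is well oriented, and assume $\mathrm{tr}(A)<\mathrm{tr}(B)$ and $\mathrm{tr}(AB)>\mathrm{tr}(B^2)$. If $\mathrm{tr}((AB)^3)>\mathrm{tr}((AB^2)^2)$, then $ab$ is the only optimal word; otherwise $ab^2$ is the only optimal word.
   Context: $\mathrm{SL}_2\mathbb{Z}_{\ge0}$ denotes the $2\times2$ matrices with nonnegative integer entries and determinant $1$. Fixed points are taken for the Möbius action on $\partial\mathcal{H}=\mathbb{P}^1\mathbb{R}$; $\alpha^\pm$ ($\beta^\pm$) are the attracting/repelling fixed points of $A$ ($B$), equal to the unique fixed point if parabolic. With $\partial\mathcal{H}$ cyclically ordered and $[\alpha,\beta]$ the closed counterclockwise interval from $\alpha$ to $\beta$, let $I^+=\{\alpha^+\}$ if $\alpha^+=\beta^+$, and otherwise the one of $[\alpha^+,\beta^+],[\beta^+,\alpha^+]$ mapped into itself by both $A$ and $B$ (if it exists); define $I^-$ likewise with $A^{-1},B^{-1},\alpha^-,\beta^-$. The pair is coherently oriented if both exist, and well oriented if $A,B$ is coherently oriented but $A,B^{-1}$ is not. Words: $F_2^+$ is the free semigroup of nonempty words over $\{a,b\}$, $|w|$ the length, $\phi(a)=A,\phi(b)=B$, $[w]=\mathrm{tr}(\phi(w))$. Define $w\preceq u$ iff $[w^{|u|}]\le[u^{|w|}]$; $w$ is maximal if $u\preceq w$ for all $u$. A Lyndon word is one strictly smaller lexicographically ($a<b$) than each of its proper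 rotations. A complete set of optimal words is a set of pairwise distinct maximal Lyndon words such that every maximal word is a power of a rotation of one of them; it is unique if it exists, and its elements are the optimal words. *)

(* Defs.v *)
From HB Require Import structures.
From mathcomp Require Import all_boot all_order all_algebra.
From mathcomp Require Import Rstruct.
Set Implicit Arguments. Unset Strict Implicit. Unset Printing Implicit Defensive.
Import Order.TTheory GRing.Theory Num.Theory.
Local Open Scope ring_scope.

Definition SL2Znn (M : 'M[int]_2) : Prop :=
  (forall i j, 0 <= M i j) /\ \det M = 1.

Definition i0 : 'I_2 := ord0.
Definition i1 : 'I_2 := ord_max.

(* ---------- P^1(R) = R u {oo}, encoded as option R (None = oo) ---------- *)
Definition mob (R : fieldType) (M : 'M[R]_2) (p : option R) : option R :=
  match p with
  | Some x => let den := M i1 i0 * x + M i1 i1 in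
              if den == 0 then None else Some ((M i0 i0 * x + M i0 i1) / den)
  | None => if M i1 i0 == 0 then None else Some (M i0 i0 / M i1 i0)
  end.

Definition hvec (R : fieldType) (p : option R) : R * R :=
  match p with Some x => (x, 1) | None => (1, 0) end.

Definition eigpt (R : fieldType) (M : 'M[R]_2) (p : option R) (l : R) : Prop :=
  M i0 i0 * (hvec p).1 + M i0 i1 * (hvec p).2 = l * (hvec p).1 /\
  M i1 i0 * (hvec p).1 + M i1 i1 * (hvec p).2 = l * (hvec p).2.

Definition fixedpt (R : fieldType) (M : 'M[R]_2) (p : option R) : Prop :=
  mob M p = p.

(* attracting (resp. repelling) fixed point: the multiplier of the fixed point
   is 1/l^2 where l is the eigenvalue; attracting iff |l| >= 1 (with equality
   exactly in the parabolic case, where the unique fixed point is both). *)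
Definition attracting (R : realFieldType) (M : 'M[R]_2) (p : option R) : Prop :=
  fixedpt M p /\ exists l, eigpt M p l /\ 1 <= `|l|.
Definition repelling (R : realFieldType) (M : 'M[R]_2) (p : option R) : Prop :=
  fixedpt M p /\ exists l, eigpt M p l /\ `|l| <= 1.

(* closed counterclockwise arc [p, q] of P^1(R) (cyclic order: increasing reals,
   then oo); [p, p] = {p}. *)
Definition in_arc (R : realFieldType) (p q z : option R) : bool :=
  match p, q with
  | Some x, Some y =>
      match z with
      | Some t => if x <= y then (x <= t) && (t <= y) else (x <= t) || (t <= y)
      | None => y < x
      end
  | Some x, None => if z is Some t then x <= t else true
  | None, Some y => if z is Some t then t <= y else true
  | None, None => z == None
  end.

Definition arc_inv (R : realFieldType) (M : 'M[R]_2) (p q : option R) : Prop :=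
  forall z, in_arc p q z -> in_arc p q (mob M z).

Definition I_exists (R : realFieldType) (M N : 'M[R]_2) (p q : option R) : Prop :=
  p = q \/
  (arc_inv M p q /\ arc_inv N p q) \/
  (arc_inv M q p /\ arc_inv N q p).

Definition coherently_oriented (R : realFieldType) (M N : 'M[R]_2) : Prop :=
  exists ap am bp bm : option R,
    attracting M ap /\ repelling M am /\ attracting N bp /\ repelling N bm /\
    I_exists M N ap bp /\ I_exists (invmx M) (invmx N) am bm.

Definition mxR (M : 'M[int]_2) : 'M[Rdefinitions.R]_2 :=
  map_mx (fun z : int => z%:~R) M.

Definition well_oriented (A B : 'M[int]_2) : Prop :=
  coherently_oriented (mxR A) (mxR B) /\
  ~ coherently_oriented (mxR A) (invmx (mxR B)).

Definition letter_mx (A B : 'M[int]_2) (l : bool) : 'M[int]_2 := if l then B else A.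
Definition phi (A B : 'M[int]_2) (w : seq bool) : 'M[int]_2 :=
  foldr (fun l M => letter_mx A B l *m M) 1%:M w.
Definition wtr (A B : 'M[int]_2) (w : seq bool) : int := \tr (phi A B w).
Definition wpow (w : seq bool) (n : nat) : seq bool := flatten (nseq n w).

Definition wle (A B : 'M[int]_2) (w u : seq bool) : Prop :=
  wtr A B (wpow w (size u)) <= wtr A B (wpow u (size w)).

Definition maximal (A B : 'M[int]_2) (w : seq bool) : Prop :=
  w != [::] /\ forall u, u != [::] -> wle A B u w.

Fixpoint lexlt (s t : seq bool) : bool :=
  match s, t with
  | [::], [::] => false
  | [::], _ :: _ => true
  | _ :: _, [::] => false
  | x :: s', y :: t' => (~~ x && y) || ((x == y) && lexlt s' t')
  end.

Definition lyndon (w : seq bool) : Prop :=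
  w != [::] /\ forall k, (0 < k < size w)%N -> lexlt w (rot k w).

(* S is a complete set of optimal words (as a set, so pairwise distinct) *)
Definition complete_optimal (A B : 'M[int]_2) (S : seq bool -> Prop) : Prop :=
  (forall w, S w -> maximal A B w /\ lyndon w) /\
  (forall w, maximal A B w -> exists u k n, S u /\ w = wpow (rot k u) n).

Definition only_optimal (A B : 'M[int]_2) (w : seq bool) : Prop :=
  complete_optimal A B (fun u => u = w) /\
  forall S, complete_optimal A B S -> forall u, S u <-> u = w.

(* Main.v *)
Require Import Defs.
From HB Require Import structures.
From mathcomp Require Import all_boot all_order all_algebra.
From mathcomp Require Import ring lra zify.
From mathcomp Require Import Rstruct.
Set Implicit Arguments. Unset Strict Implicit. Unset Printing Implicit Defensive.
Import Order.TTheory GRing.Theory Num.Theory.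
Local Open Scope ring_scope.

(** Put [x = tr A], [y = tr B], [z = tr (AB)], so that [2 <= x < y] and
    [y^2 - 1 <= z].  The criterion [tr ((AB)^3) > tr ((AB^2)^2)] holds exactly
    when [y^2 <= z] or [y < 2x]; these inequalities suffice for the argument.

    Let [u] be the candidate word, [ab] or [abb], let [l] be the left Perron
    vector of [phi u], and [sigma] the [|u|]-th root of its Perron root.
    Multiplying [l] on the right by letters, four rows (suitably rescaled) are
    enough to dominate, entrywise, every row so obtained: one more letter
    multiplies a dominating row by at most [sigma], and strictly less whenever
    the cyclic word [u] is left for good.  This is a finite automaton.  Some
    power of a word [w] labels a loop of it, so the row at that loop is
    subinvariant and the Perron root of [phi w] is at most [sigma^|w|], with
    equality only if the loop reads a power of a rotation of [u]. *)

(** * Traces and Perron roots of 2 x 2 matrices *)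

Lemma ord2P (P : 'I_2 -> Prop) : P i0 -> P i1 -> forall i, P i.
Proof.
move=> P0 P1 [[|[|//]] lt_i].
  by rewrite (_ : Ordinal lt_i = i0) //; apply: val_inj.
by rewrite (_ : Ordinal lt_i = i1) //; apply: val_inj.
Qed.

Lemma sum2E (V : nmodType) (F : 'I_2 -> V) : \sum_i F i = F i0 + F i1.
Proof.
by rewrite !big_ord_recl big_ord0 addr0; congr (_ + F _); apply: val_inj.
Qed.

Lemma mulmx2E (R : pzRingType) n (M : 'M[R]_(n, 2)) (N : 'M[R]_2) i j :
  (M *m N) i j = M i i0 * N i0 j + M i i1 * N i1 j.
Proof. by rewrite mxE sum2E. Qed.

Lemma trmx2E (R : pzRingType) (M : 'M[R]_2) : \tr M = M i0 i0 + M i1 i1.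
Proof. exact: sum2E. Qed.

Lemma det2E (R : comNzRingType) (M : 'M[R]_2) :
  \det M = M i0 i0 * M i1 i1 - M i0 i1 * M i1 i0.
Proof.
have l0 : lift i0 (ord0 : 'I_1) = i1 by apply: val_inj.
have l1 : lift i1 (ord0 : 'I_1) = i0 by apply: val_inj.
rewrite (expand_det_row _ i0) sum2E /cofactor.
rewrite [\det (row' _ (col' i0 _))]det_mx11 [\det (row' _ (col' i1 _))]det_mx11.
rewrite !mxE l0 l1 /= expr0 expr1 mul1r; ring.
Qed.

(** Cayley-Hamilton in determinant 1. The traces and rows needed later are computed with it. *)
Lemma mulmx_sqr2 (R : comNzRingType) (M : 'M[R]_2) :
  \det M = 1 -> M *m M = \tr M *: M - 1%:M.
Proof.
rewrite det2E => dM; apply/matrixP=> i j; rewrite mulmx2E trmx2E !mxE.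
move: i j; apply: ord2P; apply: ord2P; rewrite /= -?dM ?mulr1n ?mulr0n; ring.
Qed.

Lemma mxtrace_exp2 (R : comNzRingType) (M : 'M[R]_2) :
  \det M = 1 -> \tr (M ^+ 2) = \tr M ^+ 2 - 2%:R.
Proof.
by move=> dM; rewrite expr2 [M * M]mulmx_sqr2 // raddfB /= linearZ /= mxtrace1 expr2.
Qed.

Lemma mxtrace_exp3 (R : comNzRingType) (M : 'M[R]_2) :
  \det M = 1 -> \tr (M ^+ 3) = \tr M ^+ 3 - 3%:R * \tr M.
Proof.
move=> dM; rewrite exprS expr2 [X in M * X]mulmx_sqr2 // mulrBr mulr1 -scalerAr.
rewrite [M * M]mulmx_sqr2 // raddfB /= mxtraceZ raddfB /= mxtraceZ mxtrace1; ring.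
Qed.

(** The eigenvalues are [r] and [r^-1]. Both sides obey t_{k+2} = tr(M) t_{k+1} - t_k, so the
    induction carries two consecutive exponents. *)
Lemma mxtrace_expV (F : fieldType) (M : 'M[F]_2) (r : F) k :
  \det M = 1 -> r != 0 -> \tr M = r + r^-1 -> \tr (M ^+ k) = r ^+ k + r ^- k.
Proof.
move=> dM r0 tM.
suff: \tr (M ^+ k) = r ^+ k + r ^- k /\
      \tr (M ^+ k.+1) = r ^+ k.+1 + r ^- k.+1 by case.
elim: k => [|k [IH0 IH1]]; first by rewrite !expr0 invr1 mxtrace1 !expr1.
split=> //; rewrite 2!exprS mulrA [M * M]mulmx_sqr2 // mulrBl mul1r.
rewrite -[_ * M ^+ k]scalerAl -exprS raddfB /= mxtraceZ IH0 IH1 tM !exprS.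
by field; rewrite r0 expf_neq0.
Qed.

Section Trace.
Variable R : rcfType.
Implicit Types r s t : R.

(** The difference of the values at q and p factors as (q - p)(1 - 1/(pq)). Comparing traces thus
    amounts to comparing Perron roots. *)
Lemma addV_le r s : 1 <= r -> 1 <= s -> (r + r^-1 <= s + s^-1) = (r <= s).
Proof.
have mono (p q : R) : 1 <= p -> 1 <= q -> p <= q -> p + p^-1 <= q + q^-1.
  move=> p1 q1 pq; rewrite -subr_ge0.
  have -> : q + q^-1 - (p + p^-1) = (q - p) * (1 - (p * q)^-1).
    by field; apply/andP; split; apply: lt0r_neq0; lra.
  apply: mulr_ge0; first lra.
  by rewrite subr_ge0 invf_le1 ?mulr_ege1 //; nra.
have inj (p q : R) : 1 <= p -> 1 <= q -> p + p^-1 = q + q^-1 -> p <= q -> p = q.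
  move=> p1 q1 e pq; apply/eqP; rewrite eq_le pq leNgt; apply/negP => ltpq.
  have : (q - p) * (p * q - 1) = 0.
    have -> : (q - p) * (p * q - 1) = (p * q) * (q + q^-1 - (p + p^-1)).
      by field; apply/andP; split; apply: lt0r_neq0; lra.
    by rewrite e subrr mulr0.
  by move/eqP; rewrite mulf_eq0 => /orP[] /eqP; nra.
move=> r1 s1; apply/idP/idP; last exact: mono.
move=> le; rewrite leNgt; apply/negP => lt_sr.
have := mono _ _ s1 r1 (ltW lt_sr) => le'.
have e : s = r by apply: inj => //; [apply/eqP; rewrite eq_le le le' | lra].
by move: lt_sr; rewrite e ltxx.
Qed.

Lemma addV_lt r s : 1 <= r -> 1 <= s -> (r + r^-1 < s + s^-1) = (r < s).
Proof. by move=> r1 s1; rewrite !ltNge addV_le. Qed.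

Lemma ex_addV t : 2%:R <= t -> exists2 r, 1 <= r & t = r + r^-1.
Proof.
move=> t2; have d0 : 0 <= t ^+ 2 - 4%:R by nra.
have s0 := sqrtr_ge0 (t ^+ 2 - 4%:R); have := sqr_sqrtr d0.
move: s0; set s := Num.sqrt _ => s0 sE.
(* The witness is the larger root of r^2 - t r + 1. *)
have r1 : 1 <= (t + s) / 2%:R by lra.
exists ((t + s) / 2%:R) => //.
have r0 : (t + s) / 2%:R != 0 by apply: lt0r_neq0; lra.
apply: (mulIf r0); rewrite [RHS]mulrDl mulVf //.
by move: sE; rewrite !expr2; lra.
Qed.

Definition nonneg_mx (M : 'M[R]_2) := forall i j, 0 <= M i j.

Lemma mulmx_nonneg (M N : 'M[R]_2) :
  nonneg_mx M -> nonneg_mx N -> nonneg_mx (M *m N).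
Proof.
by move=> M0 N0 i j; rewrite mulmx2E addr_ge0 ?mulr_ge0.
Qed.

Lemma mxtrace_ge2 (M : 'M[R]_2) : nonneg_mx M -> \det M = 1 -> 2%:R <= \tr M.
Proof.
move=> M0; rewrite det2E trmx2E.
have := (M0 i0 i0, M0 i0 i1, M0 i1 i0, M0 i1 i1).
case=> [[[h1 h2] h3] h4] dM.
have : 0 <= M i0 i1 * M i1 i0 by apply: mulr_ge0.
by have := sqr_ge0 (M i0 i0 - M i1 i1); nra.
Qed.

Definition pos_row (v : 'rV[R]_2) := forall j, 0 < v 0 j.

(** A vanishing entry would force a zero column in [M], hence determinant 0. *)
Lemma pos_row_mul (v : 'rV[R]_2) (M : 'M[R]_2) :
  pos_row v -> nonneg_mx M -> \det M = 1 -> pos_row (v *m M).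
Proof.
move=> v0 M0 dM j; rewrite mulmx2E.
have h1 := mulr_ge0 (ltW (v0 i0)) (M0 i0 j).
have h2 := mulr_ge0 (ltW (v0 i1)) (M0 i1 j).
rewrite lt0r addr_ge0 // andbT paddr_eq0 // !mulf_eq0 !(gt_eqF (v0 _)) /=.
apply/negP => /andP[/eqP e0 /eqP e1]; move: dM; rewrite det2E.
move: j e0 e1 {h1 h2}; apply: ord2P => -> ->.
  by rewrite mul0r mulr0 subrr => /eqP; rewrite eq_sym oner_eq0.
by rewrite mul0r mulr0 subrr => /eqP; rewrite eq_sym oner_eq0.
Qed.

Lemma mulmx_row_le (v v' : 'rV[R]_2) (M : 'M[R]_2) : nonneg_mx M ->
  (forall j, v 0 j <= v' 0 j) -> forall j, (v *m M) 0 j <= (v' *m M) 0 j.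
Proof. by move=> M0 le j; rewrite !mulmx2E lerD // ler_wpM2r. Qed.

Lemma mulmx_row_lt (v v' : 'rV[R]_2) (M : 'M[R]_2) :
  nonneg_mx M -> \det M = 1 ->
  (forall j, v 0 j < v' 0 j) -> forall j, (v *m M) 0 j < (v' *m M) 0 j.
Proof.
move=> M0 dM lt j; have d0 : pos_row (v' - v).
  by move=> i; rewrite mxE [(- v) 0 i]mxE subr_gt0.
have := pos_row_mul d0 M0 dM j.
by rewrite mulmxBl mxE [(- (v *m M)) 0 j]mxE subr_gt0.
Qed.

(* A positive subinvariant row of a nonnegative matrix bounds its Perron root,
   here read off the trace since the determinant is 1. *)
Lemma mxtrace_subinv (M : 'M[R]_2) (v : 'rV[R]_2) g :
  nonneg_mx M -> \det M = 1 -> pos_row v -> 0 < g ->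
  (forall j, (v *m M) 0 j <= g * v 0 j) -> \tr M <= g + g^-1.
Proof.
move=> M0; rewrite det2E trmx2E => dM v0 g0 le.
have := (le i0, le i1, v0 i0, v0 i1, M0 i0 i1, M0 i1 i0).
rewrite !mulmx2E; case=> [[[[[]]]]].
move: dM; set a := M i0 i0; set b := M i0 i1; set c := M i1 i0; set d := M i1 i1.
set p := v 0 i0; set q := v 0 i1 => dM le0 le1 p0 q0 b0 c0.
have h0 : 0 <= q * c by rewrite mulr_ge0 // ltW.
have h1 : 0 <= p * b by rewrite mulr_ge0 // ltW.
have h0' : q * c <= (g - a) * p by lra.
have h1' : p * b <= (g - d) * q by lra.
(* Multiplying the two coordinate inequalities lets [p * q] cancel; with ad - bc = 1, what remains
   is g(a + d) <= g^2 + 1. *)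
have := ler_pM h0 h1 h0' h1' => h2.
have pq : 0 < p * q by apply: mulr_gt0.
have h3 : b * c <= (g - a) * (g - d).
  rewrite -(ler_pM2l pq).
  by rewrite (_ : _ * (b * c) = q * c * (p * b)) ?(le_trans h2) //; [lra | ring].
have h4 : g * (a + d) <= g * (g + g^-1).
  by rewrite [_ * (g + _)]mulrDr mulfV ?gt_eqF //; lra.
by rewrite ler_pM2l in h4.
Qed.

Lemma mxtrace_subinv_lt (M : 'M[R]_2) (v : 'rV[R]_2) g :
  nonneg_mx M -> \det M = 1 -> pos_row v -> 0 < g ->
  (forall j, (v *m M) 0 j < g * v 0 j) -> \tr M < g + g^-1.
Proof.
move=> M0; rewrite det2E trmx2E => dM v0 g0 le.
have := (le i0, le i1, v0 i0, v0 i1, M0 i0 i1, M0 i1 i0).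
rewrite !mulmx2E; case=> [[[[[]]]]].
move: dM; set a := M i0 i0; set b := M i0 i1; set c := M i1 i0; set d := M i1 i1.
set p := v 0 i0; set q := v 0 i1 => dM le0 le1 p0 q0 b0 c0.
have h0 : 0 <= q * c by rewrite mulr_ge0 // ltW.
have h1 : 0 <= p * b by rewrite mulr_ge0 // ltW.
have h0' : q * c < (g - a) * p by lra.
have h1' : p * b < (g - d) * q by lra.
have := ltr_pM h0 h1 h0' h1' => h2.
have pq : 0 < p * q by apply: mulr_gt0.
have h3 : b * c < (g - a) * (g - d).
  rewrite -(ltr_pM2l pq).
  by rewrite (_ : _ * (b * c) = q * c * (p * b)) ?(lt_le_trans h2) //; [lra | ring].
have h4 : g * (a + d) < g * (g + g^-1).
  by rewrite [_ * (g + _)]mulrDr mulfV ?gt_eqF //; lra.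
by rewrite ltr_pM2l in h4.
Qed.

Lemma perron_row (M : 'M[R]_2) r :
  nonneg_mx M -> \det M = 1 -> 0 < M i0 i1 -> 0 < M i1 i0 -> 1 <= r ->
  \tr M = r + r^-1 -> exists2 v, pos_row v & v *m M = r *: v.
Proof.
move=> M0; rewrite det2E trmx2E => dM b0 c0 r1 tM.
have r0 : r != 0 by apply: lt0r_neq0; lra.
have rV : r * r^-1 = 1 by rewrite mulfV.
have rV1 : r^-1 <= 1 by rewrite invf_le1 //; lra.
set a := M i0 i0 in dM tM; set b := M i0 i1 in dM b0.
set c := M i1 i0 in dM c0; set d := M i1 i1 in dM tM.
(* The product (r - a)(r - d) = bc is positive and the sum is r - 1/r >= 0, so both factors are
   positive; hence so is the left eigenvector (c, r - a). *)
have ra : 0 < r - a.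
  have bc : 0 < b * c by apply: mulr_gt0.
  have : (r - a) * (r - d) = b * c by nra.
  by rewrite ltNge; nra.
exists (\row_j (if j == i0 then c else r - a)).
  by apply: ord2P; rewrite mxE.
apply/matrixP=> i; rewrite (ord1 i).
by apply: ord2P; rewrite mulmx2E !mxE /= -/a -/b -/c -/d; nra.
Qed.

End Trace.

(** * Extremality from a dominating automaton *)

Lemma wpowS w k : wpow w k.+1 = w ++ wpow w k.
Proof. by []. Qed.

Lemma wpowD w k l : wpow w (k + l) = wpow w k ++ wpow w l.
Proof. by rewrite /wpow nseqD flatten_cat. Qed.

Lemma size_wpow w k : size (wpow w k) = (k * size w)%N.
Proof. by elim: k => // k IHk; rewrite wpowS size_cat IHk mulSn. Qed.

Lemma count_wpow a w k : count a (wpow w k) = (k * count a w)%N.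
Proof. by elim: k => // k IHk; rewrite wpowS count_cat IHk mulSn. Qed.

Lemma take_wpow w k l : (k <= l)%N -> take (k * size w) (wpow w l) = wpow w k.
Proof.
by move=> le_kl; rewrite -(subnKC le_kl) wpowD -size_wpow take_size_cat.
Qed.

(** As [v] has a single letter a ([false]), counting that letter gives m = kc, so |w| = c|v| and [w]
    is a prefix of v^m made of whole copies of [v]. *)
Lemma wpow_root w v k m : (0 < k)%N -> count_mem false v = 1%N ->
  wpow w k = wpow v m -> w = wpow v (count_mem false w).
Proof.
move=> k0 v1 e; set c := count_mem false w.
have em : m = (k * c)%N.
  by have := congr1 (count_mem false) e; rewrite !count_wpow v1 muln1.
have es : size w = (c * size v)%N.
  have := congr1 size e; rewrite !size_wpow em -mulnA => /eqP.
  by rewrite eqn_pmul2l // => /eqP.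
have -> : wpow v c = take (c * size v) (wpow v m).
  by rewrite take_wpow // em leq_pmull.
by rewrite -e -es -(prednK k0) wpowS take_size_cat.
Qed.

Lemma lexlt_irrefl s : lexlt s s = false.
Proof. by elim: s => //= x s ->; rewrite eqxx andNb. Qed.

(** For k >= 2, rotating w^k by |w| fixes it, against strict minimality. *)
Lemma lyndon_wpow w k : lyndon (wpow w k) -> k = 1%N.
Proof.
case: k => [[]|[|k] [nz lt]] //; exfalso.
have w0 : (0 < size w)%N by case: w nz {lt} => // -[]; elim: k.
have := lt (size w); rewrite size_wpow w0 mulSn -[X in (X < _)%N]addn0 ltn_add2l.
rewrite muln_gt0 w0 /= wpowS rot_size_cat => /(_ isT).
suff -> : wpow w k.+1 ++ w = w ++ wpow w k.+1 by rewrite lexlt_irrefl.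
rewrite -[RHS]wpowS -[k.+2]addn1 wpowD; congr (_ ++ _).
by rewrite /wpow /= cats0.
Qed.

(** Being Lyndon cuts a power of a rotation of [u] down to [u]. A complete set cannot be empty,
    since it must account for the maximal word [u]. *)
Lemma only_optimal_of_maximal (A B : 'M[int]_2) u : lyndon u ->
  (forall j, lyndon (rot j u) -> rot j u = u) -> maximal A B u ->
  (forall w, maximal A B w -> exists j n, w = wpow (rot j u) n) ->
  only_optimal A B u.
Proof.
move=> lyn_u rot_u max_u char.
have opt v : maximal A B v -> lyndon v -> v = u.
  move=> /char[j [n ->]] lyn; move: (lyn); rewrite (lyndon_wpow lyn).
  by rewrite /wpow /= cats0; apply: rot_u.
split=> [|S [S_opt S_all] v]; first split=> [_ -> //|w /char[j [n ->]]].
  by exists u, j, n.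
split=> [/S_opt[] | ->]; first exact: opt.
have [v' [k [n [Sv' _]]]] := S_all u max_u.
by have [mv lv] := S_opt v' Sv'; rewrite -(opt v' mv lv).
Qed.

Section Extremal.
Variables (R : rcfType) (A B : 'M[int]_2).

Definition wordmx w : 'M[R]_2 := map_mx intr (phi A B w).

Lemma wordmx_cons c w : wordmx (c :: w) = wordmx [:: c] *m wordmx w.
Proof. by rewrite /wordmx /= !map_mxM /= map_mx1 mulmx1. Qed.

Lemma wordmx_cat s t : wordmx (s ++ t) = wordmx s *m wordmx t.
Proof.
elim: s => [|c s IHs]; first by rewrite [wordmx [::]]map_mx1 mul1mx.
by rewrite cat_cons wordmx_cons IHs mulmxA -wordmx_cons.
Qed.

Lemma wordmx_wpow w k : wordmx (wpow w k) = wordmx w ^+ k.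
Proof.
elim: k => [|k IHk]; first by rewrite [wordmx _]map_mx1 expr0.
by rewrite wpowS wordmx_cat IHk exprS.
Qed.

Lemma mxtrace_wordmx w : \tr (wordmx w) = (wtr A B w)%:~R.
Proof. exact: trace_map_mx. Qed.

Hypotheses (nnA : SL2Znn A) (nnB : SL2Znn B).

Lemma wordmx1_nonneg c : nonneg_mx (wordmx [:: c]).
Proof.
move=> i j; rewrite mxE ler0z /= mulmx1.
by case: c => /=; [apply: (proj1 nnB) | apply: (proj1 nnA)].
Qed.

Lemma wordmx_nonneg w : nonneg_mx (wordmx w).
Proof.
elim: w => [|c w IHw]; last first.
  by rewrite wordmx_cons; apply/mulmx_nonneg/IHw/wordmx1_nonneg.
by move=> i j; rewrite /wordmx map_mx1 mxE ler0n.
Qed.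

Lemma det_wordmx w : \det (wordmx w) = 1.
Proof.
elim: w => [|c w IHw]; first by rewrite /wordmx map_mx1 det1.
rewrite wordmx_cons det_mulmx IHw mulr1 /wordmx det_map_mx /= mulmx1.
by case: c; rewrite /= ?(proj2 nnA) ?(proj2 nnB).
Qed.

Variables (S : finType) (delta : S -> bool -> S) (bad : S -> bool -> bool).
Variables (V : S -> 'rV[R]_2) (sigma : R).

(** [bad] marks the transitions where the bound by [sigma] is strict, so this detects a run that is
    strict somewhere. *)
Fixpoint badrun s w :=
  if w is c :: w' then bad s c || badrun (delta s c) w' else false.

Hypothesis sigma1 : 1 <= sigma.
Hypothesis V0 : forall s, pos_row (V s).
Hypothesis step_le : forall s c j, ~~ bad s c ->
  (V s *m wordmx [:: c]) 0 j <= sigma * V (delta s c) 0 j.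
Hypothesis step_lt : forall s c j, bad s c ->
  (V s *m wordmx [:: c]) 0 j < sigma * V (delta s c) 0 j.

Let sigma0 : 0 < sigma. Proof. exact: lt_le_trans ltr01 sigma1. Qed.

Lemma run_le s w j :
  (V s *m wordmx w) 0 j <= sigma ^+ size w * V (foldl delta s w) 0 j.
Proof.
elim: w s => [|c w IHw] s; first by rewrite expr0 mul1r [wordmx _]map_mx1 mulmx1.
rewrite wordmx_cons mulmxA /= exprS -mulrA.
apply: le_trans (_ : (sigma *: V (delta s c) *m wordmx w) 0 j <= _); last first.
  by rewrite -scalemxAl mxE ler_pM2l.
apply: mulmx_row_le => [|i]; first exact: wordmx_nonneg.
rewrite [leRHS]mxE.
by case: (boolP (bad s c)) => b; [apply/ltW/step_lt | apply: step_le].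
Qed.

(** Once strict in both coordinates, the inequality stays strict, because a nonnegative matrix of
    determinant 1 preserves positive rows. *)
Lemma run_lt s w j : badrun s w ->
  (V s *m wordmx w) 0 j < sigma ^+ size w * V (foldl delta s w) 0 j.
Proof.
elim: w s => [|c w IHw] s //= b.
rewrite wordmx_cons mulmxA exprS -mulrA.
have [bc|nbc] := boolP (bad s c).
  apply: lt_le_trans (_ : (sigma *: V (delta s c) *m wordmx w) 0 j <= _).
    apply: mulmx_row_lt => [||i]; [exact: wordmx_nonneg|exact: det_wordmx|].
    by rewrite [ltRHS]mxE step_lt.
  by rewrite -scalemxAl mxE ler_pM2l ?run_le.
rewrite (negPf nbc) /= in b.
apply: le_lt_trans (_ : (sigma *: V (delta s c) *m wordmx w) 0 j < _).
  apply: mulmx_row_le => [|i]; first exact: wordmx_nonneg.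
  by rewrite [leRHS]mxE step_le.
by rewrite -scalemxAl mxE ltr_pM2l // IHw.
Qed.

Lemma run_wpow s w k :
  foldl delta s (wpow w k) = iter k (fun t => foldl delta t w) s.
Proof. by elim: k s => // k IHk s; rewrite wpowS foldl_cat IHk -iterSr. Qed.

(** Pigeonhole: iterating the action of [w] on the finite set of states ends in a cycle. *)
Lemma run_loop (s0 : S) w :
  exists s k, (0 < k)%N /\ foldl delta s (wpow w k) = s.
Proof.
set f := fun t => foldl delta t w.
have /trajectP[i lt_i e] := looping_order f s0.
exists (iter i f s0), (order f s0 - i)%N; rewrite subn_gt0 lt_i; split=> //.
by rewrite run_wpow -/f -iterD subnK // ltnW.
Qed.

Variables (s0 : S) (u : seq bool).
Hypothesis u1 : count_mem false u = 1%N.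
Hypothesis tr_u : \tr (wordmx u) = sigma ^+ size u + sigma ^- size u.
Hypothesis good_loop : forall s w, foldl delta s w = s -> ~~ badrun s w ->
  exists j n, w = wpow (rot j u) n.

(** [r] is the Perron root of [w]. Some w^k labels a loop at a state [s], where [V s] is
    subinvariant, so r^k <= sigma^(k|w|). Equality excludes bad transitions, and then [good_loop]
    identifies w^k. *)
Lemma word_growth w :
  exists r, [/\ 1 <= r, \tr (wordmx w) = r + r^-1, r <= sigma ^+ size w &
    r = sigma ^+ size w -> exists j n, w = wpow (rot j u) n].
Proof.
have [r r1 tr_w] := ex_addV (mxtrace_ge2 (wordmx_nonneg w) (det_wordmx w)).
have r0 : r != 0 by apply: lt0r_neq0; exact: lt_le_trans r1.
have [s [k [k0 loop]]] := run_loop s0 w.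
have sk1 : 1 <= sigma ^+ size (wpow w k) by rewrite exprn_ege1.
have rk1 : 1 <= r ^+ k by rewrite exprn_ege1.
have tr_wk : \tr (wordmx (wpow w k)) = r ^+ k + r ^- k.
  by rewrite wordmx_wpow (mxtrace_expV k (det_wordmx w) r0 tr_w).
have sE : sigma ^+ size (wpow w k) = (sigma ^+ size w) ^+ k.
  by rewrite size_wpow mulnC exprM.
have s_gt0 : 0 < sigma ^+ size (wpow w k) by rewrite exprn_gt0.
have nnW := wordmx_nonneg (wpow w k); have detW := det_wordmx (wpow w k).
exists r; split=> //.
  suff : \tr (wordmx (wpow w k)) <=
      sigma ^+ size (wpow w k) + (sigma ^+ size (wpow w k))^-1.
    rewrite tr_wk addV_le // sE ler_pXn2r ?nnegrE // ?exprn_ge0 ?ltW //.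
    exact: lt_le_trans r1.
  apply: (@mxtrace_subinv _ _ (V s)) => // j.
  by have := run_le s (wpow w k) j; rewrite loop.
move=> er; have [b|nb] := boolP (badrun s (wpow w k)).
  have: \tr (wordmx (wpow w k)) <
      sigma ^+ size (wpow w k) + (sigma ^+ size (wpow w k))^-1.
    apply: (@mxtrace_subinv_lt _ _ (V s)) => // j.
    by have := run_lt j b; rewrite loop.
  by rewrite tr_wk addV_lt // sE -er ltxx.
have [j [n e]] := good_loop loop nb.
(* A k-th root is extracted from w^k; a rotation of [u] still has a single letter a, as [wpow_root]
   requires. *)
exists j, (count_mem false w); apply: wpow_root e => //.
by rewrite -u1; apply/permP; rewrite perm_rot.
Qed.

Lemma u_neq0 : u != [::].
Proof. by case: u u1. Qed.

Lemma extremal_maximal : maximal A B u.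
Proof.
split=> [|w w0]; first exact: u_neq0.
have [r [r1 tr_w r_le _]] := word_growth w.
have r0 : r != 0 by apply: lt0r_neq0; exact: lt_le_trans r1.
rewrite /wle -(ler_int R) -!mxtrace_wordmx !wordmx_wpow.
rewrite (mxtrace_expV _ (det_wordmx w) r0 tr_w).
rewrite (mxtrace_expV _ (det_wordmx u) _ tr_u) ?expf_neq0 ?gt_eqF //.
(* Passing from traces to Perron roots leaves r^|u| <= sigma^(|u||w|). *)
rewrite addV_le ?exprn_ege1 //.
rewrite -exprM mulnC exprM lerXn2r ?nnegrE ?exprn_ge0 ?(ltW sigma0) //.
by rewrite ltW // (lt_le_trans ltr01).
Qed.

Lemma maximal_extremal w : maximal A B w -> exists j n, w = wpow (rot j u) n.
Proof.
case=> w0 /(_ u u_neq0); have [r [r1 tr_w r_le eq_r]] := word_growth w.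
have r0 : r != 0 by apply: lt0r_neq0; exact: lt_le_trans r1.
rewrite /wle -(ler_int R) -!mxtrace_wordmx !wordmx_wpow.
rewrite (mxtrace_expV _ (det_wordmx w) r0 tr_w).
rewrite (mxtrace_expV _ (det_wordmx u) _ tr_u) ?expf_neq0 ?gt_eqF //.
rewrite addV_le ?exprn_ege1 //.
rewrite -exprM mulnC exprM ler_pXn2r ?nnegrE ?exprn_ge0 ?(ltW sigma0) //; last 2 first.
- by rewrite lt0n size_eq0 u_neq0.
- by rewrite ltW // (lt_le_trans ltr01).
by move=> r_ge; apply: eq_r; apply/eqP; rewrite eq_le r_le.
Qed.

Lemma only_optimal_extremal : lyndon u ->
  (forall j, lyndon (rot j u) -> rot j u = u) -> only_optimal A B u.
Proof.
move=> lyn_u rot_u; apply: only_optimal_of_maximal => //.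
  exact: extremal_maximal.
exact: maximal_extremal.
Qed.

End Extremal.

(** * Inequalities between traces *)

(** If y^2 <= z, then z^3 dominates y^2 z^2 and the cross term 2xyz pays for the rest. Otherwise z =
    y^2 - 1 and y <= 2x - 1. The slack 1 later absorbs [lam^-3]. *)
Lemma ab_arith (x y z : int) : 2 <= x -> x < y -> y ^+ 2 - 1 <= z ->
  y ^+ 2 <= z \/ y < 2 * x -> (y * z - x) ^+ 2 <= z ^+ 3 - 3 * z - 1.
Proof.
move=> x2 xy yz.
have [le_yz _|lt_zy] := lerP (y ^+ 2) z.
  have h1 : y ^+ 2 * z ^+ 2 <= z * z ^+ 2 by apply: ler_wpM2r; rewrite ?sqr_ge0.
  have y3 : 3 * 3 <= y * y by apply: ler_pM; lia.
  have h2 : 9 <= z by lia.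
  have h3 : x * x <= x * y by apply: ler_wpM2l; lia.
  have h : 6 <= x * y by nia.
  have h4 : 6 * z <= (x * y) * z by apply: ler_wpM2r; lia.
  have h5 : x * y * 9 <= x * y * z by apply: ler_wpM2l; lia.
  by lia.
case=> [|lt2x]; first lia.
have ez : z = y ^+ 2 - 1 by lia.
have h0 : 0 <= y ^+ 2 - 1 by nia.
have h1 : 0 <= (2 * x - y - 1) * (y * (y ^+ 2 - 1)).
  by apply: mulr_ge0; [lia | apply: mulr_ge0; lia].
have h2 : x * x <= (y - 1) * (y - 1) by apply: ler_pM; lia.
have h3 : 3 * (y * y) <= y * (y * y) by apply: ler_wpM2r; [nia | lia].
rewrite ez; lia.
Qed.

(** After substituting z = y^2 - 1, the right side minus the left is yz(y - 2x) + 2z + x^2 - 2. *)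
Lemma abb_arith (x y z : int) : 2 <= x -> 2 * x <= y -> z = y ^+ 2 - 1 ->
  z ^+ 3 - 3 * z <= (y * z - x) ^+ 2 - 2.
Proof.
move=> x2 xy ->.
have h0 : 0 <= y ^+ 2 - 1 by nia.
have h : 0 <= (y - 2 * x) * (y * (y ^+ 2 - 1)).
  by apply: mulr_ge0; [lia | apply: mulr_ge0; lia].
have h1 : 16 <= y * y by nia.
have h2 : 0 <= x * x by nia.
lia.
Qed.

(** The polynomials compared are tr((AB^2)^2) and tr((AB)^3). Over the integers the condition of
    [ab_arith] fails only if z = y^2 - 1 and 2x <= y, and there [abb_arith] settles the test the
    other way. *)
Lemma trace_dichotomy (x y z : int) : 2 <= x -> x < y -> y ^+ 2 - 2 < z ->
  y ^+ 2 - 1 <= z /\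
  if (y * z - x) ^+ 2 - 2 < z ^+ 3 - 3 * z
  then (y * z - x) ^+ 2 <= z ^+ 3 - 3 * z - 1
  else (z == y ^+ 2 - 1) && (2 * x <= y).
Proof.
move=> x2 xy lt_yz; have yz : y ^+ 2 - 1 <= z by lia.
split=> //; case: ltrP => [lt|le].
  have [|lt_z] := lerP (y ^+ 2) z; first by move=> h; apply: ab_arith => //; left.
  have [le2|lt2] := lerP (2 * x) y; last by apply: ab_arith => //; right.
  have ez : z = y ^+ 2 - 1 by lia.
  by have := abb_arith x2 le2 ez; lia.
have nab : ~ (y ^+ 2 <= z \/ y < 2 * x) by move=> /(ab_arith x2 xy yz); lia.
have lt_z : z < y ^+ 2 by rewrite ltNge; apply/negP => h; apply: nab; left.
have -> /= : z == y ^+ 2 - 1 by lia.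
by rewrite leNgt; apply/negP => h; apply: nab; right.
Qed.

(** * Coordinate inequalities behind the strict transitions *)

Section Scalars.
Variable R : rcfType.
Implicit Types x y z l m n : R.

(** [l] and [m] stand for matching coordinates of the rows l and lA, in terms of which lB and lBA
    are linear. The bounds concern lAA, lBB, lBAB and lBAA, in this order. *)
Lemma ab_bounds x y z mu l m : 2 <= x -> x + 1 <= y -> y ^+ 2 - 1 <= z ->
  (y * z - x) ^+ 2 <= z ^+ 3 - 3 * z - 1 -> 1 <= mu ->
  let lam := mu ^+ 2 in z = lam + lam^-1 -> 0 < l -> l <= m ->
  [/\ x * m - l < mu * m,
      y * (y * l - lam^-1 * m) - l < lam * l,
      y * (lam * l) - lam^-1 * (x * (lam * l) - (y * l - lam^-1 * m))
        < lam * (mu * l) &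
      x * (y * m - lam^-1 * (x * m - l)) - (y * l - lam^-1 * m) < lam * m].
Proof.
move=> x2 xy yz T2 mu1 lam ez l0 lm.
have lam1 : 1 <= lam by rewrite exprn_ege1.
have lam0 : 0 < lam by lra.
have lamk : lam * lam^-1 = 1 by rewrite mulfV ?gt_eqF.
have k1 : lam^-1 <= 1 by rewrite invf_le1.
have k0 : 0 < lam^-1 by rewrite invr_gt0.
have eL : lam = mu * mu by rewrite /lam expr2.
move: (lam) (lam^-1) eL lamk k1 k0 ez lam1 lam0 => {}lam k.
move=> eL lamk k1 k0 ez lam1 lam0.
have km : 0 < k * m by apply: mulr_gt0; lra.
have kl : k * l <= k * m by rewrite ler_pM2l.
split.
- have xmu : x <= mu by nra.
  have : x * m <= mu * m by apply: ler_wpM2r; lra.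
  by lra.
- have h1 : (y ^+ 2 - 1 - lam) * l <= k * l by apply: ler_wpM2r; lra.
  have h2 : 3 * (k * m) <= y * (k * m) by apply: ler_wpM2r; lra.
  by lra.
(* This compares tr(AB^2) with [mu ^+ 3], through squares: lam^3 = z^3 - 3z - lam^-3 >= z^3 - 3z -
   1. *)
- have T_le : y * z - x <= lam * mu.
    rewrite leNgt; apply/negP => lt.
    have lm0 : 0 < lam * mu by apply: mulr_gt0; lra.
    have h1 : (lam * mu) ^+ 2 < (y * z - x) ^+ 2 by rewrite !expr2 ltr_pM ?ltW.
    have h2 : (lam * mu) ^+ 2 = lam ^+ 3 by rewrite eL; ring.
    have h3 : k ^+ 3 <= 1 by rewrite exprn_ile1 // ltW.
    have h4 : z ^+ 3 - 3 * z = lam ^+ 3 + k ^+ 3 + 3 * (lam * k - 1) * (lam + k).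
      by rewrite ez; ring.
    by rewrite lamk in h4; lra.
  have h1 : (y * z - x) * l <= lam * mu * l by apply: ler_wpM2r; lra.
  have h2 : 0 < k * (k * m) by apply: mulr_gt0.
  have -> : y * (lam * l) - k * (x * (lam * l) - (y * l - k * m)) =
    (y * z - x) * l - k * (k * m) + (1 - lam * k) * x * l by rewrite ez; ring.
  by rewrite lamk; lra.
- have h1 : x * y <= lam by nra.
  have h2 : x * y * m <= lam * m by apply: ler_wpM2r; lra.
  have h3 : 0 < y * l by apply: mulr_gt0; lra.
  have h4 : x * (k * l) <= x * (k * m) by apply: ler_wpM2l; lra.
  have h5 : 2 * (x * (k * m)) <= x * (x * (k * m)).
    by apply: ler_wpM2r; [apply: mulr_ge0; lra | lra].
  have h6 : 2 * (k * m) <= x * (k * m) by apply: ler_wpM2r; lra.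
  by lra.
Qed.

(** [l], [m], [n] stand for matching coordinates of l, lA, lAB, and lABB = tau l yields the formula
    for [n]. The bounds concern lB, lAA, lABAB and lABAA, in this order. *)
Lemma abb_bounds x y z s l m n : 2 <= x -> 2 * x <= y -> z = y ^+ 2 - 1 ->
  1 <= s -> let tau := s ^+ 3 in y * z - x = tau + tau^-1 ->
  0 < l -> 0 < m -> m <= tau * l -> n = y^-1 * (m + tau * l) ->
  [/\ y * l - tau^-1 * n < s * l,
      x * m - l < s * m,
      z * n - l < s ^+ 2 * n &
      x * (y^-1 * ((x * m - l) + tau * m)) - n < tau * m].
Proof.
move=> x2 xy ez s1 tau eT l0 m0 mt en.
have tau1 : 1 <= tau by rewrite exprn_ege1.
have tau0 : 0 < tau by lra.
have tauk : tau * tau^-1 = 1 by rewrite mulfV ?gt_eqF.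
have k1 : tau^-1 <= 1 by rewrite invf_le1.
have k0 : 0 < tau^-1 by rewrite invr_gt0.
have eL : tau = s ^+ 3 by [].
have y0 : 0 < y by lra.
have yj : y * y^-1 = 1 by rewrite mulfV ?gt_eqF.
have j0 : 0 < y^-1 by rewrite invr_gt0.
move: (tau) (tau^-1) (y^-1) eL tauk k1 k0 yj j0 eT tau1 tau0 mt en.
move=> {}tau k j eL tauk k1 k0 yj j0 eT tau1 tau0 mt en.
have yn : y * n = m + tau * l by rewrite en mulrA yj mul1r.
have n0 : 0 < n by rewrite en; apply: mulr_gt0 => //; nra.
have j4 : 4 * j <= 1 by rewrite -yj ler_pM2r //; lra.
(* Here s^3 = tau >= y^3 - 3y/2 - 1, which exceeds (y - 1/y)^3 = y^3 - 3y + 3/y - 1/y^3. *)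
have ys : y - j <= s.
  rewrite leNgt; apply/negP => lt.
  have : s ^+ 3 < (y - j) ^+ 3 by rewrite ltrXn2r //; lra.
  have -> : (y - j) ^+ 3 = y ^+ 3 - 3 * y * (y * j) + 3 * j * (y * j) - j ^+ 3.
    by ring.
  rewrite yj -eL.
  have : 0 < j ^+ 3 by rewrite exprn_gt0.
  have : y * z = y ^+ 3 - y by rewrite ez; ring.
  by lra.
split.
- have h : j * l < k * n.
    have -> : j * l = k * (j * (tau * l)) by rewrite -[LHS]mul1r -tauk; ring.
    by rewrite ltr_pM2l // en ltr_pM2l //; lra.
  have h1 : (y - j) * l <= s * l by rewrite ler_pM2r.
  by lra.
- have h1 : x * m <= s * m by rewrite ler_pM2r //; lra.
  by lra.
(* From yn = m + tau l <= 2 tau l comes en <= l, so z - e < s^2 suffices. Cubing turns s^2 into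
   tau^2; as ze lies between 1/2 and 1, (z - e)^3 falls short of z^3 by about 3z/2 at least. *)
- pose e := y * k / 2.
  have ele : e * n <= l.
    have -> : e * n = (k * (m + tau * l)) / 2 by rewrite -yn /e; ring.
    have h1 : k * (m + tau * l) <= k * (tau * l + tau * l).
      by rewrite ler_pM2l // lerD2r.
    have h2 : k * (tau * l + tau * l) = 2 * (tau * k) * l by ring.
    rewrite tauk in h2.
    by lra.
  suff h : z - e < s ^+ 2.
    have : (z - e) * n < s ^+ 2 * n by rewrite ltr_pM2r.
    by lra.
  rewrite ltNge; apply/negP => le.
  have s0 : 0 <= s ^+ 2 by rewrite sqr_ge0.
  have h1 : tau ^+ 2 <= (z - e) ^+ 3.
    by rewrite eL -exprM mulnC exprM lerXn2r // nnegrE (le_trans s0 le).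
  have e0 : 0 < e by rewrite /e; apply: mulr_gt0; [apply: mulr_gt0|lra].
  have h2 : tau ^+ 2 = (y * z - x) ^+ 2 - 2 - k ^+ 2.
    rewrite eT; have -> : (tau + k) ^+ 2 = tau ^+ 2 + 2 * (tau * k) + k ^+ 2 by ring.
    by rewrite tauk; ring.
  have te : tau * e = y / 2 by rewrite -[y in RHS]mul1r -[X in _ = X * y / 2]tauk /e; ring.
  have z15 : 15 <= z by rewrite ez; nra.
  have yz0 : 0 < y * z by apply: mulr_gt0; lra.
  have ze : 1 / 2 <= z * e.
    rewrite -(ler_pM2l y0) [y * (z * e)]mulrA.
    have -> : y * (1 / 2) = tau * e by rewrite te; lra.
    by rewrite ler_pM2r //; lra.
  have yz15 : y * 15 <= y * z by rewrite ler_pM2l.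
  have ze1 : z * e <= 1.
    have h3 : (y * z) * e <= (2 * tau) * e by rewrite ler_pM2r //; lra.
    by rewrite -(ler_pM2l y0) [y * (z * e)]mulrA; lra.
  have e1 : e <= 1.
    have : 15 * e <= z * e by rewrite ler_pM2r.
    by lra.
  have h3 : (z - e) ^+ 3 <= z ^+ 3 - 3 / 2 * z + 3.
    have -> : (z - e) ^+ 3 = z ^+ 3 - 3 * z * (z * e) + 3 * e * (z * e) - e ^+ 3.
      by ring.
    have h4 : z * (1 / 2) <= z * (z * e) by rewrite ler_pM2l //; lra.
    have h5 : e * (z * e) <= 1 * 1 by apply: ler_pM; lra.
    have h6 : 0 < e ^+ 3 by rewrite exprn_gt0.
    by lra.
  (* The bound is the value at x = y/2, the extreme case of 2x <= y. *)
  have h4 : (y * z - x) ^+ 2 >= z ^+ 3 - 3 / 4 * z + 1 / 4.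
    have h5 : 0 <= (y - 2 * x) * (y * z - (y + 2 * x) / 4).
      by apply: mulr_ge0; lra.
    have h6 : (y * z - x) ^+ 2 = y ^+ 2 * z * z - 2 * x * y * z + x * x by ring.
    have ey : y ^+ 2 = z + 1 by rewrite ez; ring.
    have h7 : (y - 2 * x) * (y * z - (y + 2 * x) / 4) =
       y ^+ 2 * z - 2 * x * y * z - y ^+ 2 / 4 + x * x by field.
    by move: h5 h6; rewrite h7 ey; lra.
  have h5 : k ^+ 2 <= 1 by rewrite exprn_ile1 // ltW.
  by lra.
- have xj : 2 * (x * j) <= 1 by rewrite mulrA -[leRHS]yj ler_pM2r.
  have xj0 : 0 < x * j by apply: mulr_gt0; lra.
  have xt : x <= tau.
    have : s <= tau by rewrite eL exprS ler_peMr ?exprn_ege1 //; lra.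
    by lra.
  have h1 : (2 * (x * j)) * ((x + tau) * m) <= 1 * ((x + tau) * m).
    by rewrite ler_pM2r //; apply: mulr_gt0; lra.
  have h2 : 0 < (x * j) * l by apply: mulr_gt0.
  have h3 : x * m <= tau * m by rewrite ler_pM2r.
  by lra.
Qed.

End Scalars.

(** * Nonnegative integer matrices of determinant 1, and the two Lyndon words *)

Lemma row_sqr (R : comNzRingType) (v : 'rV[R]_2) (M : 'M[R]_2) :
  \det M = 1 -> v *m M *m M = \tr M *: (v *m M) - v.
Proof.
by move=> dM; rewrite -mulmxA mulmx_sqr2 // mulmxBr mulmx1 -scalemxAr.
Qed.

Lemma SL2Znn_mul (M N : 'M[int]_2) : SL2Znn M -> SL2Znn N -> SL2Znn (M *m N).
Proof.
move=> [M0 dM] [N0 dN]; split; last by rewrite det_mulmx dM dN.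
by move=> i j; rewrite mulmx2E addr_ge0 ?mulr_ge0.
Qed.

Lemma SL2Znn_diag (M : 'M[int]_2) : SL2Znn M -> forall i, 1 <= M i i.
Proof.
case=> M0; rewrite det2E => dM.
have := (M0 i0 i0, M0 i0 i1, M0 i1 i0, M0 i1 i1) => -[[[a0 b0] c0] d0].
have := mulr_ge0 b0 c0 => bc0.
have ad : 0 < M i0 i0 * M i1 i1.
  by rewrite -[ltRHS](subrK (M i0 i1 * M i1 i0)) dM ltr_pwDl.
by apply: ord2P; rewrite -gtz0_ge1 lt0r ?a0 ?d0 andbT;
  apply: contraTneq ad => ->; rewrite ?mul0r ?mulr0 ltxx.
Qed.

(** If bc = 0, then ad = 1 and the trace is only 2. *)
Lemma SL2Znn_offdiag (M : 'M[int]_2) :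
  SL2Znn M -> 2 < \tr M -> 0 < M i0 i1 /\ 0 < M i1 i0.
Proof.
move=> MP; have := (SL2Znn_diag MP i0, SL2Znn_diag MP i1).
case: MP => M0; rewrite det2E trmx2E => dM [a1 d1] t2.
have := (M0 i0 i1, M0 i1 i0) => -[b0 c0].
have bc : 0 < M i0 i1 * M i1 i0.
  by move: (M i0 i0) (M i1 i1) (M i0 i1 * M i1 i0) a1 d1 t2 dM => a d; nia.
by split; rewrite lt0r ?b0 ?c0 andbT; apply: contraTneq bc => ->;
  rewrite ?mul0r ?mulr0 ltxx.
Qed.

Lemma tr_ABB (A B : 'M[int]_2) : SL2Znn B ->
  \tr (A *m B *m B) = \tr B * \tr (A *m B) - \tr A.
Proof.
case=> _ dB; rewrite -mulmxA mulmx_sqr2 // mulmxBr mulmx1 -scalemxAr.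
by rewrite raddfB /= mxtraceZ.
Qed.

Lemma SL2Znn_tr_ge2 (M : 'M[int]_2) : SL2Znn M -> 2 <= \tr M.
Proof.
by move=> /SL2Znn_diag d1; rewrite trmx2E -[2]/(1 + 1) lerD.
Qed.

Lemma lyndon_ab : lyndon [:: false; true].
Proof. by split=> // -[|[|[]]]. Qed.

Lemma lyndon_abb : lyndon [:: false; true; true].
Proof. by split=> // -[|[|[|[]]]]. Qed.

Lemma lyndon_rot_ab j :
  lyndon (rot j [:: false; true]) -> rot j [:: false; true] = [:: false; true].
Proof. by case: j => [|[|j]] // [_ /(_ 1%N isT)]. Qed.

Lemma lyndon_rot_abb j : lyndon (rot j [:: false; true; true]) ->
  rot j [:: false; true; true] = [:: false; true; true].
Proof.
case: j => [|[|[|j]]] // [_ lt]; first by have := lt 2%N isT.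
by have := lt 1%N isT.
Qed.

Section Real.
Variable R : rcfType.

Lemma pos_perron_row (M : 'M[int]_2) (r : R) :
  SL2Znn M -> 2 < \tr M -> 1 <= r -> (\tr M)%:~R = r + r^-1 ->
  exists2 v : 'rV[R]_2, pos_row v & v *m map_mx intr M = r *: v.
Proof.
move=> MP t2 r1 tM; have [b0 c0] := SL2Znn_offdiag MP t2.
apply: perron_row; rewrite ?mxE ?ltr0z ?trace_map_mx ?det_map_mx ?(proj2 MP) //.
by move=> i j; rewrite mxE ler0z; case: MP.
Qed.

(** The diagonal of [M] is at least 1. This supplies [l <= m] in [ab_bounds] and [m <= tau * l] in
    [abb_bounds]. *)
Lemma row_le_mul (M : 'M[int]_2) (v : 'rV[R]_2) j :
  SL2Znn M -> pos_row v -> v 0 j <= (v *m map_mx intr M) 0 j.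
Proof.
move=> MP v0; have d1 := SL2Znn_diag MP; case: MP => M0 _.
rewrite mulmx2E !mxE.
have h i k : 0 <= v 0 i * (M i k)%:~R by rewrite mulr_ge0 ?ler0z // ltW.
have g i : v 0 i <= v 0 i * (M i i)%:~R by rewrite ler_peMr ?ler1z // ltW.
by move: j; apply: ord2P; [have := h i1 i0; have := g i0 |
  have := h i0 i1; have := g i1]; lra.
Qed.

Lemma wordmx1 A B c : wordmx R A B [:: c] = map_mx intr (letter_mx A B c).
Proof. by rewrite /wordmx /= mulmx1. Qed.

Lemma ex_cbrt (t : R) : 1 <= t -> exists2 s, 1 <= s & s ^+ 3 = t.
Proof.
move=> t1; have [||s /andP[s1 _] /rootP] :=
  @poly_ivt R ('X^3 - t%:P) 1 t; first exact: t1.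
  rewrite !hornerE /= subr_ge0 subr_le0 expr1n t1 /=; exact: ler_eXnr.
by rewrite !hornerE => /eqP; rewrite subr_eq0 => /eqP; exists s.
Qed.

End Real.

(** * The automata of [ab] and [abb] *)

Lemma rowZE (R : pzRingType) n c (v : 'rV[R]_n) j : (c *: v) 0 j = c * v 0 j.
Proof. by rewrite mxE. Qed.

Lemma rowBE (R : pzRingType) n (u v : 'rV[R]_n) j :
  (u - v) 0 j = u 0 j - v 0 j.
Proof. by rewrite !mxE. Qed.

(* The states [(false, false)], [(true, false)], [(false, true)], [(true, true)]
   carry the rows [l], [lA], [lB], [lBA] (up to scaling), [l] being the left
   Perron vector of [AB]; [ab_bad] marks the strict transitions. *)
Definition ab_step (s : bool * bool) (c : bool) : bool * bool :=
  match s, c with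
  | (false, false), true => (false, true)
  | (false, true), false => (true, true)
  | _, _ => (~~ c, false)
  end.

Definition ab_bad (s : bool * bool) (c : bool) : bool :=
  match s with
  | (false, false) => false
  | (true, false) => ~~ c
  | (false, true) => c
  | (true, true) => true
  end.

(* Here the rows are [l], [lA], [lAB], [lABA], in the same order, where [l] is
   the left Perron vector of [ABB]. *)
Definition abb_step (s : bool * bool) (c : bool) : bool * bool :=
  match s, c with
  | (false, false), true => (false, false)
  | (true, false), true | (true, true), true => (false, true)
  | (false, true), true => (false, false)
  | (false, true), false => (true, true)
  | _, false => (true, false)
  end.

Definition abb_bad (s : bool * bool) (c : bool) : bool :=
  match s with
  | (false, false) => c
  | (true, false) => ~~ c
  | (false, true) => false
  | (true, true) => true
  end.

(** From [(false, true)] the only letter that is not bad leads to [(true, true)], where every letter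
    is bad. A good loop from the other two states thus alternates between them, and letters are
    peeled off in pairs. *)
Lemma ab_run s w : s.2 = false -> foldl ab_step s w = s ->
  ~~ badrun ab_step ab_bad s w ->
  exists n, w = wpow (rot s.1 [:: false; true]) n.
Proof.
have [k] := ubnP (size w); elim: k => // k IHk in s w *.
case: s => [[] []] // lt_k _; case: w lt_k => [|[] [|[] w]] //= lt_k.
- by exists 0%N.
- by case: w lt_k => [|[] [|c w]].
- move=> e nb; have [|n ->] := IHk (true, false) w _ erefl e nb; first by lia.
  by exists n.+1.
- by exists 0%N.
- by case: w lt_k.
- move=> e nb; have [|n ->] := IHk (false, false) w _ erefl e nb; first by lia.
  by exists n.+1.
Qed.

Lemma ab_loop s w : foldl ab_step s w = s -> ~~ badrun ab_step ab_bad s w ->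
  exists j n, w = wpow (rot j [:: false; true]) n.
Proof.
case: s => [s1 []]; last first.
  by move=> e nb; have [//|n ->] := ab_run _ e nb; exists s1, n.
case: s1; case: w => [|[] [|c w]] //= _ _; exists 0%N, 0%N => //.
Qed.

(** Away from [(true, true)], the position reached in the cyclic word abb, hence the rotation read
    by a good loop. *)
Definition abb_pos (s : bool * bool) : nat :=
  if s.1 then 1 else if s.2 then 2 else 0.

(** A detour to [(true, true)] cannot be left without a bad transition, so a good loop reads the
    cyclic word, three letters per turn. *)
Lemma abb_run s w : s != (true, true) -> foldl abb_step s w = s ->
  ~~ badrun abb_step abb_bad s w ->
  exists n, w = wpow (rot (abb_pos s) [:: false; true; true]) n.
Proof.
have [k] := ubnP (size w); elim: k => // k IHk in s w *.
case: s => [[] []] // lt_k _; case: w lt_k => [|[] [|[] [|[] w]]] //= lt_k.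
- by exists 0%N.
- move=> e nb; have [||n ->] := IHk (true, false) w _ _ e nb => //; first by lia.
  by exists n.+1.
- by exists 0%N.
- move=> e nb; have [||n ->] := IHk (false, true) w _ _ e nb => //; first by lia.
  by exists n.+1.
- by exists 0%N.
- move=> e nb; have [||n ->] := IHk (false, false) w _ _ e nb => //; first by lia.
  by exists n.+1.
- by case: w lt_k.
Qed.

Lemma abb_loop s w : foldl abb_step s w = s -> ~~ badrun abb_step abb_bad s w ->
  exists j n, w = wpow (rot j [:: false; true; true]) n.
Proof.
have [->|s_tt e nb] := eqVneq s (true, true).
  by case: w => // _ _; exists 0%N, 0%N.
by have [n ->] := abb_run s_tt e nb; exists (abb_pos s), n.
Qed.

(** * The rows of the two automata for the pair [A], [B] *)

Section Optimal.
Variables (R : rcfType) (A B : 'M[int]_2).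
Hypotheses (nnA : SL2Znn A) (nnB : SL2Znn B).
Let x : int := \tr A. Let y : int := \tr B. Let z : int := \tr (A *m B).
Hypotheses (xy : x < y) (yz : y ^+ 2 - 1 <= z).

Let a : 'M[R]_2 := map_mx intr A.
Let b : 'M[R]_2 := map_mx intr B.

Let x2 : 2 <= x. Proof. exact: SL2Znn_tr_ge2. Qed.

Let x2R : 2 <= x%:~R :> R. Proof. by rewrite -[2]/(2%:~R) ler_int. Qed.

Let det_a : \det a = 1. Proof. by rewrite det_map_mx (proj2 nnA). Qed.
Let det_b : \det b = 1. Proof. by rewrite det_map_mx (proj2 nnB). Qed.
Let tr_a : \tr a = x%:~R. Proof. exact: trace_map_mx. Qed.
Let tr_b : \tr b = y%:~R. Proof. exact: trace_map_mx. Qed.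

Let nn_a : nonneg_mx a.
Proof. by move=> i j; rewrite mxE ler0z; case: nnA. Qed.
Let nn_b : nonneg_mx b.
Proof. by move=> i j; rewrite mxE ler0z; case: nnB. Qed.

Let castE := (rmorphB, rmorphXn, rmorphM, rmorph1).

Lemma only_optimal_ab : (y * z - x) ^+ 2 <= z ^+ 3 - 3 * z - 1 ->
  only_optimal A B [:: false; true].
Proof.
move=> T2.
have z3 : 2 < z by nia.
have [|lam lam1 z_lam] := @ex_addV R z%:~R.
  by rewrite -[2%:R]/(2%:~R) ler_int ltW.
have lam0 : 0 < lam by exact: lt_le_trans lam1.
(* The growth per letter is the square root of [lam], as ab has two letters. *)
have [mu mu1 mu2] : exists2 mu, 1 <= mu & mu ^+ 2 = lam.
  exists (Num.sqrt lam); last by rewrite sqr_sqrtr // ltW.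
  by rewrite -sqrtr1 ler_wsqrtr.
have mu0 : 0 < mu by exact: lt_le_trans mu1.
have [l l0] := pos_perron_row (SL2Znn_mul nnA nnB) z3 lam1 z_lam.
rewrite map_mxM mulmxA -/a -/b => e_l.
pose m := l *m a; pose k := lam^-1.
have lamN0 : lam != 0 by rewrite gt_eqF.
have muN0 : mu != 0 by rewrite gt_eqF.
have ma : m *m a = x%:~R *: m - l by rewrite row_sqr // tr_a.
have mb : m *m b = lam *: l by [].
have lb : l *m b = y%:~R *: l - k *: m.
  have lE : l = k *: (m *m b) by rewrite mb scalerA mulVf // scale1r.
  rewrite {1}lE -scalemxAl row_sqr // tr_b mb scalerBr !scalerA.
  by rewrite mulrAC mulVf // mul1r.
have m0 : pos_row m by exact: pos_row_mul.
have lb0 : pos_row (l *m b) by exact: pos_row_mul.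
have lba0 : pos_row (l *m b *m a) by exact: pos_row_mul.
have bounds j : [/\ x%:~R * m 0 j - l 0 j < mu * m 0 j,
    y%:~R * (l *m b) 0 j - l 0 j < lam * l 0 j,
    (l *m b *m a *m b) 0 j < lam * (mu * l 0 j) &
    (l *m b *m a *m a) 0 j < lam * m 0 j].
  have -> : l *m b *m a *m b = y%:~R *: (lam *: l)
      - k *: (x%:~R *: (lam *: l) - l *m b).
    by rewrite [in LHS]lb !mulmxBl -!scalemxAl ma !mulmxBl -!scalemxAl mb.
  have -> : l *m b *m a *m a = x%:~R *: (y%:~R *: m - k *: (x%:~R *: m - l))
      - l *m b.
    by rewrite row_sqr // tr_a [in X in _ *: X]lb mulmxBl -!scalemxAl ma.
  rewrite lb !(rowBE, rowZE) /k -mu2; apply: (@ab_bounds R _ _ z%:~R) => //.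
  - by rewrite -[1]/(1%:~R) -intrD ler_int lezD1.
  - by move: yz; rewrite -(ler_int R) !castE.
  - by move: T2; rewrite -(ler_int R) !castE.
  - by rewrite mu2.
  - exact: row_le_mul.
(* Dividing by [mu] once per letter read from [l] turns the transitions that are not bad into
   equalities. *)
pose V s := match s with
  | (false, false) => l
  | (true, false) => mu^-1 *: m
  | (false, true) => mu^-1 *: (l *m b)
  | (true, true) => lam^-1 *: (l *m b *m a)
  end.
apply: (@only_optimal_extremal R A B nnA nnB _ ab_step ab_bad V mu mu1
  _ _ _ (false, false)) => //.
- case=> [[] []] j; rewrite /V ?rowZE ?mulr_gt0 ?invr_gt0 //.
- move=> s c j; rewrite wordmx1.
  case: s c => [[] []] [] //= _; rewrite -/a -/b -?scalemxAl ?mb !rowZE.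
  + by rewrite -mu2 le_eqVlt; apply/orP; left; apply/eqP; field.
  + by rewrite -mu2 le_eqVlt; apply/orP; left; apply/eqP; field.
  + by rewrite mulVKf.
  + by rewrite mulVKf.
- move=> s c j; rewrite wordmx1; have [b1 b2 b3 b4] := bounds j.
  case: s c => [[] []] [] //= _; rewrite -/a -/b -?scalemxAl !rowZE.
  + by rewrite ltr_pdivrMl.
  + by rewrite mulVKf // ltr_pdivrMl.
  + by rewrite mulVKf // ltr_pdivrMl // ma rowBE rowZE.
  + by rewrite ltr_pdivrMl // row_sqr // tr_b rowBE rowZE mulrA -expr2 mu2.
- rewrite mxtrace_wordmx /wtr /= mulmx1 -/z z_lam mu2 //.
- exact: ab_loop.
- exact: lyndon_ab.
- exact: lyndon_rot_ab.
Qed.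

Lemma only_optimal_abb : z = y ^+ 2 - 1 -> 2 * x <= y ->
  only_optimal A B [:: false; true; true].
Proof.
move=> ez xy2.
have T3 : 2 < \tr (A *m B *m B) by rewrite tr_ABB // -/x -/y -/z; nia.
have [|tau tau1 T_tau] := @ex_addV R (\tr (A *m B *m B))%:~R.
  by rewrite -[2%:R]/(2%:~R) ler_int ltW.
have tau0 : 0 < tau by exact: lt_le_trans tau1.
have tauN0 : tau != 0 by rewrite gt_eqF.
have [s s1 s3] := ex_cbrt tau1.
have s0 : 0 < s by exact: lt_le_trans s1.
have sN0 : s != 0 by rewrite gt_eqF.
have [l l0] := pos_perron_row (SL2Znn_mul (SL2Znn_mul nnA nnB) nnB) T3 tau1 T_tau.
rewrite !map_mxM !mulmxA -/a -/b => e_l.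
pose m := l *m a; pose n := m *m b; pose k := tau^-1.
have m0 : pos_row m by exact: pos_row_mul.
have n0 : pos_row n by exact: pos_row_mul.
have na0 : pos_row (n *m a) by exact: pos_row_mul.
have nb : n *m b = tau *: l by [].
have yN0 : y%:~R != 0 :> R by rewrite intr_eq0; lia.
have ma : m *m a = x%:~R *: m - l by rewrite row_sqr // tr_a.
(* Solve nB = mBB = yn - m for [n], with nB = tau l. *)
have nE : n = y%:~R^-1 *: (m + tau *: l).
  by rewrite -nb row_sqr // tr_b addrC subrK scalerK.
have lb : l *m b = y%:~R *: l - k *: n.
  have lE : l = k *: (n *m b) by rewrite nb scalerA mulVf // scale1r.
  rewrite {1}lE -scalemxAl row_sqr // tr_b nb scalerBr !scalerA.
  by rewrite mulrAC mulVf // mul1r.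
have bounds j : [/\ (l *m b) 0 j < s * l 0 j, (m *m a) 0 j < s * m 0 j,
    (n *m a *m b) 0 j < s ^+ 2 * n 0 j & (n *m a *m a) 0 j < tau * m 0 j].
  have -> : n *m a *m b = z%:~R *: n - l.
    rewrite -[n *m a *m b]mulmxA /n /m -[l *m a *m b]mulmxA row_sqr; last first.
      by rewrite det_mulmx det_a det_b mulr1.
    by rewrite -map_mxM trace_map_mx.
  have -> : n *m a *m a
      = x%:~R *: (y%:~R^-1 *: ((x%:~R *: m - l) + tau *: m)) - n.
    rewrite row_sqr // tr_a [in X in _ *: X]nE.
    by rewrite -scalemxAl mulmxDl -scalemxAl ma.
  have nj : n 0 j = y%:~R^-1 * (m 0 j + tau * l 0 j).
    by rewrite [in LHS]nE rowZE mxE rowZE.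
  have addE (u v : 'rV[R]_2) : (u + v) 0 j = u 0 j + v 0 j by rewrite mxE.
  rewrite lb ma !(rowBE, rowZE, addE) /k -s3; apply: (@abb_bounds R) => //.
  - by move: xy2; rewrite -(ler_int R) !castE.
  - by rewrite ez !castE.
  - by rewrite s3 -T_tau tr_ABB // !castE.
  - rewrite s3 -rowZE -nb (le_trans (row_le_mul j nnB m0)) //.
    exact: row_le_mul.
  - by rewrite s3.
(* The scaling is again by one factor [s] per letter, with s^3 = tau. *)
pose V t := match t with
  | (false, false) => l
  | (true, false) => s^-1 *: m
  | (false, true) => (s ^+ 2)^-1 *: n
  | (true, true) => tau^-1 *: (n *m a)
  end.
have s20 : 0 < s ^+ 2 by rewrite exprn_gt0.
apply: (@only_optimal_extremal R A B nnA nnB _ abb_step abb_bad V s s1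
  _ _ _ (false, false)) => //.
- by case=> [[] []] j; rewrite /V ?rowZE ?mulr_gt0 ?invr_gt0.
- move=> t c j; rewrite wordmx1.
  case: t c => [[] []] [] //= _; rewrite -/a -/b -?scalemxAl ?nb !rowZE -?/n.
  + by rewrite le_eqVlt; apply/orP; left; apply/eqP; field.
  + by rewrite -s3 le_eqVlt; apply/orP; left; apply/eqP; field.
  + by rewrite -s3 le_eqVlt; apply/orP; left; apply/eqP; field.
  + by rewrite mulVKf.
- move=> t c j; rewrite wordmx1; have [b1 b2 b3 b4] := bounds j.
  case: t c => [[] []] [] //= _; rewrite -/a -/b -?scalemxAl !rowZE.
  + rewrite ltr_pdivrMl // (_ : tau * _ = s ^+ 2 * n 0 j) //.
    by rewrite -s3; field.
  + by rewrite mulVKf // ltr_pdivrMl.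
  + by rewrite mulVKf // ltr_pdivrMl.
- rewrite mxtrace_wordmx /wtr /= mulmx1 mulmxA T_tau s3 //.
- exact: abb_loop.
- exact: lyndon_abb.
- exact: lyndon_rot_abb.
Qed.

End Optimal.

Theorem theorem7p5 (A B : 'M[int]_2) :
  SL2Znn A -> SL2Znn B -> A *m B != B *m A -> well_oriented A B ->
  \tr A < \tr B -> \tr (B *m B) < \tr (A *m B) ->
  (\tr ((A *m B *m B) ^+ 2) < \tr ((A *m B) ^+ 3) ->
     only_optimal A B [:: false; true]) /\
  (~ (\tr ((A *m B *m B) ^+ 2) < \tr ((A *m B) ^+ 3)) ->
     only_optimal A B [:: false; true; true]).
Proof.
move=> nnA nnB _ _ xy; have dB := proj2 nnB.
rewrite -[B *m B]/(B ^+ 2) mxtrace_exp2 // => yz.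
have nnC := SL2Znn_mul nnA nnB; have nnD := SL2Znn_mul nnC nnB.
rewrite mxtrace_exp2 ?mxtrace_exp3 ?(proj2 nnC) ?(proj2 nnD) // tr_ABB //.
have [{}yz] := trace_dichotomy (SL2Znn_tr_ge2 nnA) xy yz.
(* The split replaces the trace test by its truth value, so one of the two implications becomes
   vacuous. *)
case: ifP => _ => [T2|/andP[/eqP ez xy2]]; split=> // _.
  exact: (only_optimal_ab Rdefinitions.R).
exact: (only_optimal_abb Rdefinitions.R).
Qed.
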